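(* Let $Q\in\mathcal B$ and $0\le\alpha<\gamma\le 1$. (i) Let $\epsilon>0$ be such that $\mathcal H^{\gamma,\alpha}_\epsilon(\Lambda,\phi_0)(Q)>0$. Then $$\mathcal H_\alpha(\Lambda,\phi_0)(Q)\ \ge\ \mathcal H^{\gamma,\alpha}_\epsilon(\Lambda,\phi_0)(Q)\,\min\Big\{e^{-\frac{\gamma-\alpha}{\mathcal H^{\gamma,\alpha}_\epsilon(\Lambda,\phi_0)(Q)}\mathcal D^{\gamma,\alpha}_\epsilon(Q)},\,e\Big\}-\epsilon ,$$ and, if $\Lambda(Q)>0$, $$\Phi(Q)\ \ge\ \Lambda(Q)\min\Big\{e^{-\frac1{\Lambda(Q)}\mathcal K_\alpha(\Lambda|\phi_0)(Q)},\,e^{\frac1{1-\alpha}}\Big\}.$$ (ii) Suppose $\Lambda(Q)>0$. Then $$\mathcal H_\alpha(\Lambda,\phi_0)(Q)\ \ge\ \Lambda(Q)e^{-\frac{1-\alpha}{\Lambda(Q)}\mathcal K_{\alpha,\epsilon}(\Lambda|\phi_0)(Q)}-\epsilon$$ for all $0\le\alpha_0\le\alpha$ and all $0<\epsilon<\Lambda(Q)\Big(e-\big(\mathcal H_{\alpha_0}(\Lambda,\phi_0)(Q)/\Lambda(Q)\big)^{(1-\alpha)/(1-\alpha_0)}\Big)$, and $$\mathcal H_\alpha(\Lambda,\phi_0)(Q)\ \ge\ \Lambda(Q)e^{-\frac{1-\alpha}{\Lambda(Q)}\mathcal K_{\alpha}(\Lambda|\phi_0)(Q)}$$ if $\mathcal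 H_{\alpha_0}(\Lambda,\phi_0)(Q)<\Lambda(Q)e^{(1-\alpha_0)/(1-\alpha)}$ for some $0\le\alpha_0\le\alpha$.
   Context: Setting. Let $X$ be a set, $S:X\to X$ a bijection, $\mathcal A$ a $\sigma$-algebra on $X$, $\mathcal A_0$ the $\sigma$-algebra generated by $\bigcup_{i\ge 0}S^{-i}\mathcal A$, $\mathcal B$ the $\sigma$-algebra generated by $\bigcup_{i\in\mathbb Z}S^{-i}\mathcal A$, and $\mathcal A_m:=S^{-m}\mathcal A_0=\{S^{-m}A:A\in\mathcal A_0\}$ for integers $m\le 0$ (so $\mathcal A_0\subset\mathcal A_{-1}\subset\cdots$). Let $\phi_0$ be a finite positive measure on $\mathcal A_0$, and $\Lambda$ a finite positive measure on $\mathcal A_0$ with $\Lambda\circ S^{-1}=\Lambda$ and $\Lambda\ll\phi_0$; let $Z\ge0$ be an $\mathcal A_0$-measurable version of $d\Lambda/d\phi_0$. For $Q\subset X$ let $\mathcal C(Q)$ be the set of all sequences $(A_m)_{m\le0}$ with $A_m\in\mathcal A_m$ for all $m\le 0$ and $Q\subset\bigcup_{m\le0}A_m$. Define $\Phi(Q):=\inf_{(A_m)\in\mathcal C(Q)}\sum_{m\le0}\phi_0(S^mA_m)$. The symbol $\Lambda$ also denotes $\Lambda(Q):=\inf_{(A_m)\in\mathcal C(Q)}\sum_{m\le0}\Lambda(S^mA_m)$, $Q\subset X$; its restriction to $\mathcal B$ is the unique $S$-invariant measure on $\mathcal B$ extending $\Lambda$. Conventions: extended real numbers are used, $0\log0:=0$,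 $y^x:=e^{x\log y}$ and thus $0^0:=1$, $1/\infty:=0$, $e^{-\infty}:=0$. For $\alpha\ge0$ and $Q\subset X$: $\mathcal H_\alpha(\Lambda,\phi_0)(Q):=\inf_{(A_m)\in\mathcal C(Q)}\sum_{m\le0}\int_{S^mA_m}Z^\alpha d\phi_0$ (so $\mathcal H_0=\Phi$, $\mathcal H_1=\Lambda$). For $\epsilon>0$ and $0\le\alpha\le1$ let $\mathcal C^\alpha_\epsilon(Q):=\{(A_m)\in\mathcal C(Q):\sum_{m\le0}\int_{S^mA_m}Z^\alpha d\phi_0<\mathcal H_\alpha(\Lambda,\phi_0)(Q)+\epsilon\}$. For $0\le\alpha<\gamma\le1$: $\mathcal H^{\gamma,\alpha}_\epsilon(\Lambda,\phi_0)(Q):=\inf_{(A_m)\in\mathcal C^\alpha_\epsilon(Q)}\sum_{m\le0}\int_{S^mA_m}Z^\gamma d\phi_0$, and $\mathcal D^{\gamma,\alpha}_\epsilon(Q):=\inf_{(A_m)\in\mathcal C^\alpha_\epsilon(Q)}\sum_{m\le0}\int_{S^mA_m}Z^\gamma\log Z\,d\phi_0$ (these sums are well defined in $(-\infty,\infty]$). Further $\mathcal K_{\alpha,\epsilon}(\Lambda|\phi_0)(Q):=\mathcal D^{1,\alpha}_\epsilon(Q)$ and $\mathcal K_\alpha(\Lambda|\phi_0)(Q):=\lim_{\epsilon\to0}\mathcal K_{\alpha,\epsilon}(\Lambda|\phi_0)(Q)$. *)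

(* Defs.v *)
From HB Require Import structures.
From mathcomp Require Import all_boot all_order all_algebra.
From mathcomp Require Import all_classical all_reals all_analysis.
From mathcomp Require Import measurable_realfun.

Set Implicit Arguments.
Unset Strict Implicit.
Unset Printing Implicit Defensive.

Import Order.TTheory GRing.Theory Num.Theory.
Import numFieldNormedType.Exports.

Local Open Scope classical_set_scope.
Local Open Scope ring_scope.
Local Open Scope ereal_scope.

(* The sigma-algebra A on X is the one carried by X : measurableType d.
   The index m <= 0 is encoded by n : nat with m = - n; thus A n stands for
   A_m, and S^m A_m for [zimage S (- n%:Z) (A n)]. *)

Section shift.
Context {d : measure_display} {X : measurableType d}.
Implicit Types (S : X -> X) (B Q : set X) (A : nat -> set X).

(* The set S^i B; this is the i-th power of S only for bijective S. *)
Definition zimage S (i : int) B : set X :=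
  match i with
  | Posz n => iter n S @` B
  | Negz n => iter n.+1 S @^-1` B
  end.

Definition past_gen S : set (set X) :=
  \bigcup_i [set zimage S (- i%:Z)%R B | B in (measurable : set (set X))].

Definition full_gen S : set (set X) :=
  \bigcup_(i in [set: int])
    [set zimage S (- i)%R B | B in (measurable : set (set X))].

Definition past S : set (set X) := <<s past_gen S >>.

Definition full S : set (set X) := <<s full_gen S >>.

(* A_m = S^{-m} A_0 with m = - n. *)
Definition past_at S (n : nat) : set (set X) :=
  [set zimage S n%:Z B | B in past S].

Definition coverings S Q : set (nat -> set X) :=
  [set A | (forall n, past_at S n (A n)) /\ Q `<=` \bigcup_n A n].

End shift.

(* X equipped with the sigma-algebra A_0. *)
Notation pastType S := (g_sigma_algebraType (past_gen S)).

Section hellinger_kullback.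
Context {d : measure_display} {X : measurableType d} {R : realType}.
Variable S : X -> X.
Implicit Types (mu : set (pastType S) -> \bar R) (Q : set X).

(* Phi is [outer phi0]; the extension of Lambda is [outer Lambda]. *)
Definition outer mu Q : \bar R :=
  ereal_inf [set \sum_(n <oo) mu (zimage S (- n%:Z)%R (A n))
            | A in coverings S Q].

Variables (phi0 : {finite_measure set (pastType S) -> \bar R})
          (Z : pastType S -> \bar R).

Definition cover_sum (f : pastType S -> \bar R) (A : nat -> set X) : \bar R :=
  \sum_(n <oo) \int[phi0]_(x in (zimage S (- n%:Z)%R (A n) : set (pastType S))) f x.

Definition hellinger (alpha : R) Q : \bar R :=
  ereal_inf [set cover_sum (fun x => Z x `^ alpha) A | A in coverings S Q].

Definition near_coverings (alpha eps : R) Q : set (nat -> set X) :=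
  [set A | coverings S Q A /\
    cover_sum (fun x => Z x `^ alpha) A < hellinger alpha Q + eps%:E].

Definition hellinger_eps (gamma alpha eps : R) Q : \bar R :=
  ereal_inf [set cover_sum (fun x => Z x `^ gamma) A
            | A in near_coverings alpha eps Q].

(* At Z x = 0 and gamma > 0 the integrand is 0 * -oo = 0. *)
Definition hellinger_log_eps (gamma alpha eps : R) Q : \bar R :=
  ereal_inf [set cover_sum (fun x => Z x `^ gamma * lne (Z x)) A
            | A in near_coverings alpha eps Q].

Definition kullback_eps (alpha eps : R) Q : \bar R :=
  hellinger_log_eps 1%R alpha eps Q.

Definition kullback (alpha : R) Q : \bar R :=
  lim (kullback_eps alpha eps Q @[eps --> (0 : R)^'+]).

End hellinger_kullback.

(* Z is a nonnegative A_0-measurable version of dLambda/dphi0; the value +oo is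
   allowed (necessarily on a phi0-null set). *)
Definition is_density {d : measure_display} {T : measurableType d}
    {R : realType} (nu mu : set T -> \bar R) (Z : T -> \bar R) : Prop :=
  [/\ forall x, 0 <= Z x,
      measurable_fun [set: T] Z &
      forall B, measurable B -> nu B = \int[mu]_(x in B) Z x].

(* Main.v *)
Require Import Defs.
From HB Require Import structures.
From mathcomp Require Import all_boot all_order all_algebra.
From mathcomp Require Import all_classical all_reals all_analysis.
From mathcomp Require Import measurable_realfun.
From mathcomp Require Import ring lra.
Import Order.TTheory GRing.Theory Num.Theory.
Import numFieldNormedType.Exports.
Local Open Scope classical_set_scope.
Local Open Scope ring_scope.
Local Open Scope ereal_scope.

(** For [s >= -1], convexity of the exponential gives the pointwise bound
    [e^-s (1+s) z^g <= z^a + e^-s (g-a) z^g ln z].  Integrating it along a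
    covering that is nearly optimal for [H_a] bounds [H_a] from below by an
    affine function of the Kullback-type functional; the best [s] yields
    [min (e^(- ...), e)].

    To pass from [H_a] to [Phi = H_0] (or to [H_a0]) one needs Hoelder's
    inequality [H_a <= H_a0^p * Lambda^(1-p)] with [p = (1-a)/(1-a0)].  It follows
    from Young's inequality once some covering is nearly optimal for [H_a0] and
    [Lambda] simultaneously.  Such a covering exists because, for any finite
    measure [phi] on the past, the past sets are Caratheodory measurable for the
    outer measure [outer phi], and [outer phi] is shift-invariant on them.  So one
    intersects a disjoint covering nearly optimal for [phi] with one for [Lambda]
    and re-covers each (past-measurable) piece nearly optimally for [phi],
    which by finite additivity and invariance costs nothing for [Lambda].  Only
    finite additivity at each level is used, so [Q] may be arbitrary. *)

Set Implicit Arguments.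
Unset Strict Implicit.
Unset Printing Implicit Defensive.

(** * Coverings by sets of the shifted past *)

Section shift_covers.
Context {d : measure_display} {P : measurableType d} {R : realType}.
Variables (S : P -> P) (mS : measurable_fun [set: P] S).

Local Notation pre n A := (iter n S @^-1` A).

Lemma preimage_iterD j k (A : set P) : pre (j + k) A = pre k (pre j A).
Proof. by apply/seteqP; split=> x; rewrite /= iterD. Qed.

Lemma measurable_pre n A : measurable A -> measurable (pre n A).
Proof.
elim: n => // n IH mA; rewrite -addn1 preimage_iterD.
by rewrite -[X in measurable X]setTI; apply: mS => //; exact: IH.
Qed.

Lemma measurable_preD j k A : measurable (pre j A) -> measurable (pre (j + k) A).
Proof. by move=> mA; rewrite preimage_iterD; exact: measurable_pre. Qed.

Lemma measurable_pre_leq j k A :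
  (j <= k)%N -> measurable (pre j A) -> measurable (pre k A).
Proof. by move=> jk mA; rewrite -(subnKC jk); exact: measurable_preD. Qed.

(** * Invariant contents on sets of different levels *)

Section content.
Variable nu : set P -> \bar R.
Hypothesis nu_ge0 : forall A, 0 <= nu A.
Hypothesis nu_le : forall A B, measurable A -> measurable B ->
  A `<=` B -> nu A <= nu B.
Hypothesis nu_add : forall A B, measurable A -> measurable B ->
  A `&` B = set0 -> nu A + nu B <= nu (A `|` B).
Hypothesis nu_inv : forall A, measurable A -> nu (S @^-1` A) = nu A.

Lemma content_pre_leq j k A : (j <= k)%N -> measurable (pre j A) ->
  nu (pre k A) = nu (pre j A).
Proof.
move=> jk mA; rewrite -(subnKC jk) preimage_iterD.
elim: (k - j)%N => // n IH.
rewrite -addn1 preimage_iterD nu_inv //.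
exact: measurable_pre.
Qed.

(** Finitely many pieces can be pulled back to one common level, where finite additivity applies,
    and invariance keeps their values. This is applied both to a measure and to
    [shift_outer phi]. *)
Lemma content_disjoint_le (l : nat -> nat) (D : nat -> set P) j V :
  (forall i, measurable (pre (l i) (D i))) -> trivIset setT D ->
  measurable (pre j V) -> (forall i, D i `<=` V) ->
  \sum_(i <oo) nu (pre (l i) (D i)) <= nu (pre j V).
Proof.
move=> mD tD mV DV; apply: lime_le; first by apply: is_cvg_nneseries.
apply: nearW => n.
(* The sum of all the levels is a crude common upper bound for [j] and the [l i] with [i < n]. *)
pose L := (j + \sum_(0 <= i < n) l i)%N.
have jL : (j <= L)%N by rewrite leq_addr.
have lL i : (i < n)%N -> (l i <= L)%N.
  move=> ni; apply: leq_trans (leq_addl _ _).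
  by rewrite big_mkord (bigD1 (Ordinal ni))//= leq_addr.
rewrite big_nat (eq_bigr (fun i => nu (pre L (D i)))); last first.
  by move=> i /andP[_ ni]; rewrite (@content_pre_leq (l i) L)//; exact: lL.
rewrite -big_nat.
have mL i : (i < n)%N -> measurable (pre L (D i)).
  by move=> ni; apply: measurable_pre_leq (mD i); exact: lL.
have mU m : (m <= n)%N -> measurable (\big[setU/set0]_(0 <= i < m) pre L (D i)).
  elim: m => [|m IH] mn; first by rewrite big_geq.
  by rewrite big_nat_recr//=; apply: measurableU; [exact/IH/ltnW|exact: mL].
suff H m : (m <= n)%N -> \sum_(0 <= i < m) nu (pre L (D i)) <=
    nu (\big[setU/set0]_(0 <= i < m) pre L (D i)).
  apply: le_trans (H _ (leqnn n)) _.
  rewrite -(@content_pre_leq j L)//; apply: nu_le; first exact: mU.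
    exact: measurable_pre_leq mV.
  by rewrite big_mkord -(bigcup_mkord n (fun i => pre L (D i))) => x [i _ /DV].
elim: m => [|m IH] mn; first by rewrite !big_geq.
rewrite !big_nat_recr//=.
apply: le_trans (nu_add _ _ _); [|exact/mU/ltnW|exact: mL|].
  by rewrite leeD2r// IH// ltnW.
rewrite big_mkord setIC -subset0 => x [Dx].
rewrite -(bigcup_mkord m (fun i => pre L (D i))) => -[i /= im Di].
have := @tD m i Logic.I Logic.I; move=> H.
have E : m = i by apply: H; exists (iter L S x).
by rewrite E ltnn in im.
Qed.

End content.

(** For bijective [S], being the [n]-th forward image of a past set amounts to having a measurable
    [n]-th preimage; this form avoids direct images. *)
Definition shift_cover Q : set (nat -> set P) :=
  [set A | (forall n, measurable (pre n (A n))) /\ Q `<=` \bigcup_n A n].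

Definition shift_outer (mu : set P -> \bar R) Q : \bar R :=
  ereal_inf [set \sum_(n <oo) mu (pre n (A n)) | A in shift_cover Q].

(** * The outer functional of a finite measure *)

Section outer.
Variable mu : {measure set P -> \bar R}.
Hypothesis muT : mu setT < +oo.
Hypothesis bijS : bijective S.

Local Notation Phi := (shift_outer mu).

Lemma shift_outer_ge0 Q : 0 <= Phi Q.
Proof. by apply: le_ereal_inf_tmp => _ [A _ <-]; exact: nneseries_ge0. Qed.

Lemma shift_outer_le Q A : shift_cover Q A ->
  Phi Q <= \sum_(n <oo) mu (pre n (A n)).
Proof. by move=> QA; apply: ereal_inf_lbound; exists A. Qed.

Lemma le_shift_outer A B : A `<=` B -> Phi A <= Phi B.
Proof.
move=> AB; apply: le_ereal_inf_tmp => _ [C [mC BC] <-].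
by apply: shift_outer_le; split => //; exact: subset_trans BC.
Qed.

Lemma shift_outer_le_measure C : measurable C -> Phi C <= mu C.
Proof.
move=> mC; pose A n := if n is 0%N then C else set0.
have CA : shift_cover C A.
  split=> [[|n]//=|x Cx]; last by exists 0%N.
  by rewrite preimage_set0.
apply: le_trans (shift_outer_le CA) _.
rewrite nneseries_recl// eseries0 ?adde0// => -[//|n] _ _.
by rewrite /= preimage_set0 measure0.
Qed.

Lemma shift_outer_fin_num Q : Phi Q \is a fin_num.
Proof.
rewrite ge0_fin_numE ?shift_outer_ge0//; apply: le_lt_trans muT.
exact: le_trans (le_shift_outer (@subsetT _ Q)) (shift_outer_le_measure _).
Qed.

Lemma shift_outer_adherent Q (e : R) : (0 < e)%R ->
  exists A, shift_cover Q A /\ \sum_(n <oo) mu (pre n (A n)) <= Phi Q + e%:E.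
Proof.
move=> e0; have [_ [A QA <-] /ltW ?] := lb_ereal_inf_adherent e0 (shift_outer_fin_num Q).
by exists A.
Qed.

(** Coverings of the [F i] are merged level by level: a countable union of sets of level [k] is
    again of level [k], so the merged family still has one set per level. *)
Lemma shift_outer_sigma_subadditive (F : nat -> set P) :
  Phi (\bigcup_i F i) <= \sum_(i <oo) Phi (F i).
Proof.
apply/lee_addgt0Pr => e e0.
have de n : (0 < e / (2 ^ n.+1)%:R)%R by rewrite divr_gt0// ltr0n expn_gt0.
have [A PA] := choice (fun n => shift_outer_adherent (F n) (de n)).
apply: le_trans (epsilon_trick xpredT (fun n => shift_outer_ge0 (F n)) (ltW e0)).
apply: (@le_trans _ _ (\sum_(k <oo) mu (pre k (\bigcup_n A n k)))).
  apply: shift_outer_le; split=> [k|x [i _ Fix]].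
    rewrite preimage_bigcup; apply: bigcupT_measurable => n.
    by have [[+ _] _] := PA n; exact.
  have [[_ /(_ _ Fix)[k _ Aik]] _] := PA i.
  by exists k => //; exists i.
apply: (@le_trans _ _ (\sum_(k <oo) \sum_(n <oo) mu (pre k (A n k)))).
  apply: lee_nneseries => // k _; rewrite preimage_bigcup.
  have mA n : measurable (pre k (A n k)) by have [[+ _] _] := PA n; exact.
  apply: measure_sigma_subadditive => //; exact: bigcupT_measurable.
rewrite nneseries_interchange//; apply: lee_nneseries => n _; last first.
  by have [_] := PA n.
by move=> _; exact: nneseries_ge0.
Qed.

Lemma shift_outerU A B : Phi (A `|` B) <= Phi A + Phi B.
Proof.
rewrite -bigcup2E; apply: le_trans (shift_outer_sigma_subadditive _) _.
rewrite (nneseries_split _ 2); last by move=> k _; exact: shift_outer_ge0.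
rewrite eseries0; last first.
  move=> [|[|n]]// _ _; apply/eqP; rewrite eq_le shift_outer_ge0 andbT.
  by rewrite -[leRHS](measure0 mu); exact: (shift_outer_le_measure measurable0).
by rewrite adde0 !big_nat_recr//= big_geq// add0e.
Qed.

(** Every level contains the past, so [C] cuts each member of a covering into two sets of the same
    level, on which [mu] adds up. *)
Lemma shift_outer_caratheodory Q C : measurable C ->
  Phi (Q `&` C) + Phi (Q `\` C) <= Phi Q.
Proof.
move=> mC; apply: le_ereal_inf_tmp => _ [A [mA QA] <-].
have mpC n : measurable (pre n C) by exact: measurable_pre.
rewrite (@eq_eseriesr _ _ (fun n => mu (pre n (A n `&` C)) + mu (pre n (A n `\` C)))).
  rewrite nneseriesD//; apply: leeD; apply: shift_outer_le; split.
  - by move=> n; exact: (measurableI _ _ (mA n) (mpC n)).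
  - by move=> x [/QA[n _ Anx] Cx]; exists n.
  - by move=> n; exact: (measurableD (mA n) (mpC n)).
  - by move=> x [/QA[n _ Anx] Cx]; exists n.
move=> n _; rewrite addeC; exact: (measureDI mu (mA n) (mpC n)).
Qed.

(** Applying [S] to a covering of the preimage of [D] gives a covering of [D] with the same sum,
    each member one level further and level 0 left empty. Level 0 has no level below it, so the same
    move does not work backwards. *)
Lemma shift_outer_le_pre k Q : Phi Q <= Phi (pre k Q).
Proof.
have [g SK gK] := bijS.
have step D : Phi D <= Phi (S @^-1` D).
  apply: le_ereal_inf_tmp => _ [A [mA QA] <-].
  pose B n := if n is m.+1 then S @` (A m) else set0.
  have SB n : pre n.+1 (B n.+1) = pre n (A n).
    apply/seteqP; split=> x /=; last by move=> Ax; exists (iter n S x).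
    by move=> [y Ay /(can_inj SK) <-].
  have DB : shift_cover D B.
    split=> [[|n]|x Dx]; [by rewrite preimage_set0|by rewrite SB|].
    have [|n _ An] := QA (g x); first by rewrite /= gK.
    by exists n.+1 => //; exists (g x).
  apply: le_trans (shift_outer_le DB) _.
  have B0 : mu (pre 0 (B 0%N)) = 0 by rewrite preimage_set0 measure0.
  rewrite [leLHS]nneseries_recl// B0 add0e.
  rewrite -(@nneseries_addn _ (fun i => mu (pre i (B i))) 1) //.
  by apply: lee_nneseries => // n _; rewrite addn1 SB.
elim: k => // k IH; apply: le_trans IH _.
by rewrite -addn1 preimage_iterD; exact: step.
Qed.

Lemma shift_outer_superadditive A B : measurable A -> measurable B ->
  A `&` B = set0 -> Phi A + Phi B <= Phi (A `|` B).
Proof.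
move=> mA mB AB0; apply: le_trans (shift_outer_caratheodory (A `|` B) mA).
apply: leeD; apply: le_shift_outer => x; first by split; [left|].
move=> Bx; split; first by right.
by move=> Ax; have : (A `&` B) x by []; rewrite AB0.
Qed.

(* Phi increases along both C and its complement under the shift, while the
   total mass is finite and preserved. *)
Lemma shift_outer_inv C : measurable C -> Phi (S @^-1` C) = Phi C.
Proof.
move=> mC; apply/eqP; rewrite eq_le (shift_outer_le_pre 1) andbT.
have mSC : measurable (S @^-1` C) by exact: (@measurable_pre 1).
have H : Phi (S @^-1` C) + Phi (~` (S @^-1` C)) <= Phi C + Phi (~` C).
  apply: le_trans (shift_outer_superadditive _ _ _) _ => //.
  - exact: measurableC.
  - by rewrite setICr.
  - by rewrite setUv -(setUv C); exact: shift_outerU.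
have H2 : Phi (~` C) <= Phi (~` (S @^-1` C)) by exact: (shift_outer_le_pre 1).
move: H H2.
rewrite -(fineK (shift_outer_fin_num C)) -(fineK (shift_outer_fin_num (~` C))).
rewrite -(fineK (shift_outer_fin_num (S @^-1` C))).
rewrite -(fineK (shift_outer_fin_num (~` (S @^-1` C)))).
rewrite -!EFinD !lee_fin; lra.
Qed.

End outer.

(** * Coverings nearly optimal for two measures at once *)

Section common_cover.
Variables phi lam mu : {measure set P -> \bar R}.
Hypothesis phiT : phi setT < +oo.
Hypothesis lamT : lam setT < +oo.
Hypothesis lam_inv : forall A, measurable A -> lam (S @^-1` A) = lam A.
Hypothesis muE : forall A, mu A = phi A + lam A.
Hypothesis bijS : bijective S.

Let lam_le A B : measurable A -> measurable B -> A `<=` B -> lam A <= lam B.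
Proof. by move=> mA mB AB; apply: le_measure => //; rewrite inE. Qed.

Let lam_add A B : measurable A -> measurable B -> A `&` B = set0 ->
  lam A + lam B <= lam (A `|` B).
Proof. by move=> mA mB AB0; rewrite measureU. Qed.

(** [seqDU] removes from [A n] only members of smaller index, and these are measurable at level [n]
    because the levels increase. *)
Lemma measurable_pre_seqDU (A : nat -> set P) n :
  (forall n, measurable (pre n (A n))) -> measurable (pre n (seqDU A n)).
Proof.
move=> mA; rewrite (_ : pre n _ = pre n (A n) `\` \bigcup_(k in `I_n) pre n (A k));
  last by rewrite /seqDU -bigcup_mkord.
apply: measurableD => //; apply: bigcup_measurable => k /= kn.
exact: measurable_pre_leq (ltnW kn) (mA k).
Qed.

(** A covering of [C] nearly optimal for [phi] is made disjoint and cut down to [C]. This does not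
    raise its [phi]-sum, and its [lam]-sum is at most [lam C] by disjointness and invariance. *)
Lemma shift_outer_add_measurable C : measurable C ->
  shift_outer mu C <= shift_outer phi C + lam C.
Proof.
move=> mC; apply/lee_addgt0Pr => e e0.
have [A [[mA CA] Ae]] := shift_outer_adherent phiT C e0.
pose B n := seqDU A n `&` C.
have mB n : measurable (pre n (B n)).
  by apply: measurableI; [exact: measurable_pre_seqDU|exact: measurable_pre].
have tB : trivIset setT B by apply: trivIset_setIr; exact: trivIset_seqDU.
have CB : shift_cover C B.
  split => // x Cx; have := CA x Cx; rewrite seqDU_bigcup_eq => -[n _ An].
  by exists n.
apply: le_trans (shift_outer_le mu CB) _.
rewrite (eq_eseriesr (fun n _ => muE _)) nneseriesD// addeAC.
apply: leeD.
  apply: le_trans Ae; apply: lee_nneseries => // n _.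
  apply: le_measure; rewrite ?inE// => x [+ _]; exact: subset_seqDU.
apply: (@content_disjoint_le lam _ _ _ _ id B 0) => //.
by move=> n x [].
Qed.

(** Nearly optimal coverings for [phi] and for [lam] are made disjoint and intersected, and each
    piece is covered anew. The [phi]-costs are grouped by the members [V' j], the [lam]-costs by the
    members [U' i], so the double sum is taken in two orders. *)
Lemma shift_outer_add Q :
  shift_outer mu Q <= shift_outer phi Q + shift_outer lam Q.
Proof.
have Phi_ge0 := shift_outer_ge0 phi.
apply/lee_addgt0Pr => e e0; have e20 : (0 < e / 2)%R by rewrite divr_gt0.
have [V [[mV QV] Ve]] := shift_outer_adherent phiT Q e20.
have [U [[mU QU] Ue]] := shift_outer_adherent lamT Q e20.
pose V' := seqDU V; pose U' := seqDU U.
have mV' n : measurable (pre n (V' n)) by exact: measurable_pre_seqDU.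
have mU' n : measurable (pre n (U' n)) by exact: measurable_pre_seqDU.
(* The level [i + j] serves because it bounds both [i] and [j]. *)
pose W i j := U' i `&` V' j.
have mW i j : measurable (pre (i + j) (W i j)).
  apply: measurableI; first exact: measurable_pre_leq (leq_addr _ _) (mU' i).
  exact: measurable_pre_leq (leq_addl _ _) (mV' j).
have mu_ge0 := shift_outer_ge0 mu.
have QW : Q `<=` \bigcup_i \bigcup_j W i j.
  move=> x Qx; have := QU x Qx; rewrite seqDU_bigcup_eq => -[i _ Ui].
  have := QV x Qx; rewrite seqDU_bigcup_eq => -[j _ Vj].
  by exists i => //; exists j.
apply: le_trans (le_shift_outer mu QW) _.
have muT : mu setT < +oo by rewrite muE lte_add_pinfty.
apply: le_trans (shift_outer_sigma_subadditive muT _) _.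
apply: (@le_trans _ _ (\sum_(i <oo) \sum_(j <oo)
    (shift_outer phi (pre (i + j) (W i j)) + lam (pre (i + j) (W i j))))).
  apply: lee_nneseries => // i _.
  apply: le_trans (shift_outer_sigma_subadditive muT _) _.
  apply: lee_nneseries => // j _.
  (* Pulling the piece back into the past can only raise its outer value, and there the bound for
     measurable sets applies. *)
  apply: le_trans (shift_outer_le_pre mu bijS (i + j) _) _.
  exact: shift_outer_add_measurable.
under eq_eseriesr do rewrite nneseriesD//.
rewrite nneseriesD; [|by move=> i *; exact: nneseries_ge0..].
rewrite (splitr e) EFinD addeACA; apply: leeD.
  (* For fixed [j] the pieces are disjoint subsets of [V' j], and [shift_outer phi] is an invariant,
     finitely additive content on the past. *)
  rewrite nneseries_interchange//; apply: le_trans Ve.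
  apply: lee_nneseries => [j _ _|j _]; first exact: nneseries_ge0.
  apply: (@le_trans _ _ (phi (pre j (V' j)))); last first.
    by apply: le_measure; rewrite ?inE// => x; exact: subset_seqDU.
  apply: le_trans (shift_outer_le_measure phi (mV' j)).
  apply: (@content_disjoint_le (shift_outer phi) _ _ _ _
    (fun i => i + j)%N (fun i => W i j) j) => //.
  - by move=> A B _ _; exact: le_shift_outer.
  - by move=> A B; exact: shift_outer_superadditive.
  - by move=> A; exact: shift_outer_inv.
  - by apply: trivIset_setIr; exact: trivIset_seqDU.
  - by move=> i x [].
(* For fixed [i] the pieces are disjoint subsets of [U' i], and [lam] is an invariant measure. *)
apply: le_trans Ue; apply: lee_nneseries => [i _ _|i _]; first exact: nneseries_ge0.
apply: (@le_trans _ _ (lam (pre i (U' i)))); last first.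
  by apply: le_measure; rewrite ?inE// => x; exact: subset_seqDU.
apply: (@content_disjoint_le lam _ _ _ _ (fun j => i + j)%N (W i) i) => //.
  by apply: trivIset_setIl; exact: trivIset_seqDU.
by move=> j x [].
Qed.

(** A covering nearly optimal for the sum [mu] works: its excesses over the two outer values are
    nonnegative and, by [shift_outer_add], total at most [e]. *)
Lemma common_shift_cover Q (e : R) : (0 < e)%R ->
  exists A, [/\ shift_cover Q A,
    \sum_(n <oo) phi (pre n (A n)) <= shift_outer phi Q + e%:E &
    \sum_(n <oo) lam (pre n (A n)) <= shift_outer lam Q + e%:E].
Proof.
move=> e0; have muT : mu setT < +oo by rewrite muE lte_add_pinfty.
have [A [QA]] := shift_outer_adherent muT Q e0.
rewrite (eq_eseriesr (fun n _ => muE _)) nneseriesD// => Ae.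
exists A; split => //.
all: have /le_trans := Ae => /(_ _ (leeD (shift_outer_add Q) (lexx _))).
all: have := shift_outer_le phi QA; have := shift_outer_le lam QA.
all: have := shift_outer_fin_num phiT Q; have := shift_outer_fin_num lamT Q.
all: have : 0 <= \sum_(n <oo) phi (pre n (A n)) by exact: nneseries_ge0.
all: have : 0 <= \sum_(n <oo) lam (pre n (A n)) by exact: nneseries_ge0.
all: case: (\sum_(n <oo) phi _) => [p||]//; case: (\sum_(n <oo) lam _) => [l||]//.
all: case: (shift_outer phi Q) => [p'||]//; case: (shift_outer lam Q) => [l'||]// _ _ _ _.
all: by rewrite -!EFinD !lee_fin; lra.
Qed.

End common_cover.
End shift_covers.

(** * Pointwise inequalities and their integrals *)

Section scalar_inequalities.
Context {R : realType}.
Implicit Types (x y m s t : R) (z : \bar R).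

Lemma expR_tangent m x : (expR m * (1 + (x - m)) <= expR x)%R.
Proof.
have -> : expR x = (expR m * expR (x - m))%R by rewrite -expRD addrC subrK.
by rewrite ler_wpM2l ?expR_ge0//; exact: expR_ge1Dx.
Qed.

(** Since [a = p a0 + (1 - p)], the power $z^a$ is the weighted geometric mean of
    $e^{(1-p)t}z^{a_0}$ and $e^{-pt}z$, hence at most their weighted arithmetic mean. The free [t]
    later selects the optimal case of Hoelder's inequality. *)
Lemma poweR_young (a0 a p t : R) z : (0 <= a0)%R -> (a0 <= a)%R -> (a < 1)%R ->
  (p * (1 - a0) = 1 - a)%R -> 0 <= z ->
  z `^ a <= (p * expR ((1 - p) * t))%:E * z `^ a0
            + ((1 - p) * expR (- (p * t)))%:E * z.
Proof.
move=> a00 a0a a1 pE z0.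
have d0 : (0 < 1 - a0)%R by lra.
have [aa0|aa0] := eqVneq a a0.
  have -> : p = 1%R by apply: (mulIf (lt0r_neq0 d0)); lra.
  rewrite aa0.
  by rewrite subrr !mul0r expR0 mulr1 mul1e mul0e adde0.
have {}a0a : (a0 < a)%R by rewrite lt_neqAle eq_sym aa0.
have p0 : (0 < p)%R by nra.
have p1 : (0 < 1 - p)%R by nra.
have c1 : (0 <= p * expR ((1 - p) * t))%R by rewrite mulr_ge0 ?expR_ge0// ltW.
have c2 : (0 < (1 - p) * expR (- (p * t)))%R by rewrite mulr_gt0 ?expR_gt0.
case: z z0 => [r||//].
  rewrite lee_fin le_eqVlt => /predU1P[<-|r0].
    rewrite mule0 adde0 /= powR0; last by rewrite gt_eqF//; lra.
    by rewrite -EFinM lee_fin mulr_ge0// powR_ge0.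
  rewrite /= -!EFinM -EFinD lee_fin /powR gt_eqF//.
  rewrite -{3}(lnK r0) -!mulrA -!expRD.
  (* Both tangents are taken at [a * ln r]; weighted by [p] and [1 - p], their linear terms
     cancel. *)
  have := expR_tangent (a * ln r) ((1 - p) * t + a0 * ln r).
  have := expR_tangent (a * ln r) (- (p * t) + ln r).
  set w := ln r; set E1 := expR (_ + w); set E2 := expR (_ + _ * w).
  set E := expR _ => H1 H2.
  have {}H1 : ((1 - p) * (E * (1 + (- (p * t) + w - a * w))) <= (1 - p) * E1)%R.
    by rewrite ler_wpM2l// ltW.
  have {}H2 : (p * (E * (1 + ((1 - p) * t + a0 * w - a * w))) <= p * E2)%R.
    by rewrite ler_wpM2l// ltW.
  apply: le_trans (lerD H2 H1); rewrite le_eqVlt; apply/orP; left; apply/eqP.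
  have -> : a = (1 - p * (1 - a0))%R by lra.
  ring.
rewrite [X in _ <= _ + X]gt0_muley ?lte_fin// addey ?leey//.
by rewrite -ltNye (@lt_le_trans _ _ 0)// mule_ge0 ?poweR_ge0// lee_fin.
Qed.

(* Written with positive and negative parts so that both sides are nonnegative
   and integrate termwise. *)
Lemma poweR_log_tangent (a g s : R) z : (0 <= a)%R -> (a < g)%R -> (-1 <= s)%R ->
  0 <= z ->
  (expR (- s) * (1 + s))%:E * z `^ g +
    (expR (- s) * (g - a))%:E * maxe (- (z `^ g * lne z)) 0
  <= z `^ a + (expR (- s) * (g - a))%:E * maxe (z `^ g * lne z) 0.
Proof.
move=> a0 ag s1 z0.
have g0 : (0 < g)%R by lra.
have c0 : (0 < expR (- s) * (g - a))%R by rewrite mulr_gt0 ?expR_gt0//; lra.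
case: z z0 => [r||//].
  rewrite lee_fin le_eqVlt => /predU1P[<-|r0].
    rewrite /= powR0 ?gt_eqF// lexx !mul0e oppe0 maxxx !mule0 !adde0.
    by rewrite lee_fin powR_ge0.
  rewrite lne_EFin// !poweR_EFin -!EFinM -!EFinN -!EFin_max -!EFinM -!EFinD lee_fin.
  rewrite /powR gt_eqF//.
  have := ler_wpM2r (expR_ge0 (g * ln r)) (expR_tangent (- s) (- ((g - a) * ln r))).
  rewrite -[X in (_ <= X)%R -> _]expRD.
  have -> : (- ((g - a) * ln r) + g * ln r = a * ln r)%R by ring.
  set G := expR (g * _); set c := expR (- s); set w := ln r.
  set f := (G * w)%R.
  have -> : (Num.max (- f) 0 = Num.max f 0 - f)%R.
    by case: (lerP f 0) => ?; case: (lerP (- f) 0) => ?; lra.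
  move=> H; apply: (le_trans _ (lerD H (lexx _))); rewrite /f.
  rewrite le_eqVlt; apply/orP; left; apply/eqP; ring.
rewrite /= gt_eqF// mulyy maxye [X in _ <= _ + X]gt0_muley ?lte_fin//.
by rewrite addey ?leey//; case: ifP.
Qed.

End scalar_inequalities.

Lemma nneseriesB {R : realType} (p q : nat -> \bar R) :
  (forall i, 0 <= p i) -> (forall i, 0 <= q i) -> \sum_(i <oo) q i < +oo ->
  \sum_(i <oo) (p i - q i) = \sum_(i <oo) p i - \sum_(i <oo) q i.
Proof.
move=> p0 q0 qoo.
have cp : cvgn (fun n => \sum_(0 <= i < n) p i) by exact: is_cvg_nneseries.
have cq : cvgn (fun n => \sum_(0 <= i < n) q i) by exact: is_cvg_nneseries.
have q_fin : \sum_(i <oo) q i \is a fin_num.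
  by rewrite ge0_fin_numE//; exact: nneseries_ge0.
have qi_fin i : q i \is a fin_num.
  rewrite ge0_fin_numE//; apply: le_lt_trans qoo.
  by rewrite (@nneseriesD1 _ _ i xpredT)//= leeDl//; exact: nneseries_ge0.
rewrite (_ : (fun n => _) = (fun n => \sum_(0 <= i < n) p i) \-
    (fun n => \sum_(0 <= i < n) q i)); last first.
  apply/funext => n; rewrite big_split/= sumeN// => i j _ _.
  by rewrite fin_num_adde_defl.
apply/cvg_lim => //; apply: cvgeB => //.
by rewrite fin_num_adde_defl// fin_numN.
Qed.

(** * Series of integrals along a covering *)

Section integral_series.
Context {d : measure_display} {T : measurableType d} {R : realType}.
Variables (mu : {measure set T -> \bar R}) (B : nat -> set T).
Hypothesis mB : forall n, measurable (B n).

Local Notation isum f := (\sum_(n <oo) \int[mu]_(x in B n) f x).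

Lemma integral_series_ge0 (f : T -> \bar R) : (forall x, 0 <= f x) -> 0 <= isum f.
Proof. by move=> f0; apply: nneseries_ge0 => n _ _; exact: integral_ge0. Qed.

Lemma le_integral_series (f g : T -> \bar R) :
  (forall x, 0 <= f x) -> measurable_fun setT f -> measurable_fun setT g ->
  (forall x, f x <= g x) -> isum f <= isum g.
Proof.
move=> f0 mf mg fg; apply: lee_nneseries => [n _ _|n _]; first exact: integral_ge0.
by apply: ge0_le_integral => //; exact: measurable_funTS.
Qed.

Lemma integral_seriesD (f g : T -> \bar R) :
  (forall x, 0 <= f x) -> (forall x, 0 <= g x) ->
  measurable_fun setT f -> measurable_fun setT g ->
  isum (f \+ g) = isum f + isum g.
Proof.
move=> f0 g0 mf mg.
rewrite -nneseriesD; [|by move=> n _ _; exact: integral_ge0..].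
apply: eq_eseriesr => n _.
by apply: ge0_integralD => //; exact: measurable_funTS.
Qed.

Lemma integral_seriesZl (k : R) (f : T -> \bar R) : (0 <= k)%R ->
  (forall x, 0 <= f x) -> measurable_fun setT f ->
  isum (fun x => k%:E * f x) = k%:E * isum f.
Proof.
move=> k0 f0 mf; rewrite -nneseriesZl; last by move=> n _; exact: integral_ge0.
apply: eq_eseriesr => n _.
by apply: ge0_integralZl_EFin => //; exact: measurable_funTS.
Qed.

Lemma integral_series_posneg (f : T -> \bar R) : measurable_fun setT f ->
  isum f^\- < +oo -> isum f = isum f^\+ - isum f^\-.
Proof.
move=> mf fn; rewrite -nneseriesB//.
- by apply: eq_eseriesr => n _; rewrite integralE.
- by move=> n; apply: integral_ge0 => x _; exact: funepos_ge0.
- by move=> n; apply: integral_ge0 => x _; exact: funeneg_ge0.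
Qed.

End integral_series.

(** [lne] is increasing, with value -oo at nonpositive reals, so the preimage of the ray above [r]
    is the ray above [expR r]. *)
Lemma measurable_lne {R : realType} : measurable_fun [set: \bar R] (@lne R).
Proof.
move=> _; apply: (measurability _ (ErealGenOInfty.measurableE R)) => //.
move=> _ [_ [r ->] <-]; rewrite setTI.
have -> : @lne R @^-1` `]r%:E, +oo[ = `](expR r)%:E, +oo[%classic.
  apply/seteqP; split => z /=; rewrite !in_itv/= !andbT.
    case: z => [z| |]//=; last by rewrite !ltry.
    have [//|z0] := leP z 0%R; rewrite !lte_fin.
    by move=> rz; rewrite -(lnK z0) ltr_expR.
  case: z => [z| |]//=; last by rewrite !ltry.
  rewrite lte_fin => rz.
  have z0 : (0 < z)%R by exact: lt_trans (expR_gt0 r) rz.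
  by rewrite leNgt z0/= lte_fin -(expRK r) ltr_ln ?posrE ?expR_gt0.
exact: emeasurable_itv.
Qed.

Section tangent_series.
Context {d : measure_display} {T : measurableType d} {R : realType}.
Variables (mu : {measure set T -> \bar R}) (B : nat -> set T).
Hypothesis mB : forall n, measurable (B n).
Variable Z : T -> \bar R.
Hypothesis Z_ge0 : forall x, 0 <= Z x.
Hypothesis mZ : measurable_fun setT Z.

Local Notation isum f := (\sum_(n <oo) \int[mu]_(x in B n) f x).

Lemma measurable_poweR_comp (a : R) : measurable_fun setT (fun x => Z x `^ a).
Proof. exact: (measurableT_comp (measurable_poweR a)). Qed.

(** The pointwise bound is integrated in its form with nonnegative sides. The negative part of the
    logarithmic integrand then has a finite series and can be moved to the other side. *)
Lemma tangent_series (a g s : R) : (0 <= a)%R -> (a < g)%R -> (-1 <= s)%R ->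
  isum (fun x => Z x `^ a) < +oo ->
  (expR (- s) * (1 + s))%:E * isum (fun x => Z x `^ g) <=
  isum (fun x => Z x `^ a) +
  (expR (- s) * (g - a))%:E * isum (fun x => Z x `^ g * lne (Z x)).
Proof.
move=> a0 ag s1 aoo.
pose f x := Z x `^ g * lne (Z x).
have mP := measurable_poweR_comp.
have P0 b x : 0 <= Z x `^ b by exact: poweR_ge0.
have mf : measurable_fun setT f.
  apply: emeasurable_funM; first exact: mP.
  exact: (measurableT_comp measurable_lne).
have mfp : measurable_fun setT f^\+ by exact: measurable_funepos.
have mfn : measurable_fun setT f^\- by exact: measurable_funeneg.
have fp0 x : 0 <= f^\+ x by exact: funepos_ge0.
have fn0 x : 0 <= f^\- x by exact: funeneg_ge0.
have c_gt0 t : (0 < expR (- t) * (g - a))%R by rewrite mulr_gt0 ?expR_gt0 ?subr_gt0.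
have b_ge0 : (0 <= expR (- s) * (1 + s))%R by rewrite mulr_ge0 ?expR_ge0//; lra.
(* At [s = -1] the $z^g$ term drops out, so the negative part is dominated by a multiple of
   $Z^a$. *)
have fn_le x : (expR (- -1) * (g - a))%:E * f^\- x <= Z x `^ a.
  have := poweR_log_tangent a0 ag (lexx (-1)%R) (Z_ge0 x).
  rewrite subrr mulr0 mul0e add0e funenegE -/(f x).
  have [fx|fx] := leP (f x) 0.
    by rewrite mule0 adde0.
  move=> _; rewrite (_ : maxe _ _ = 0) ?mule0//.
  by apply/max_idPr; rewrite leeNl oppe0 ltW.
have fn_oo : isum f^\- < +oo.
  rewrite -(@lte_pmul2l _ (expR (- -1) * (g - a))%:E) ?lte_fin//.
  rewrite gt0_muley ?lte_fin// -integral_seriesZl// ?ltW//.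
  apply: le_lt_trans aoo; apply: le_integral_series => //.
    by move=> x; rewrite mule_ge0// lee_fin ltW.
  exact: emeasurable_funM.
have main : (expR (- s) * (1 + s))%:E * isum (fun x => Z x `^ g)
      + (expR (- s) * (g - a))%:E * isum f^\-
    <= isum (fun x => Z x `^ a) + (expR (- s) * (g - a))%:E * isum f^\+.
  have c_ge0 := ltW (c_gt0 s).
  rewrite -!integral_seriesZl// -!integral_seriesD//;
    try exact: emeasurable_funM;
    try by move=> x; apply: mule_ge0; rewrite ?lee_fin.
  apply: le_integral_series => //.
  - by move=> x; rewrite adde_ge0// mule_ge0// lee_fin.
  - by apply: emeasurable_funD; exact: emeasurable_funM.
  - by apply: emeasurable_funD => //; exact: emeasurable_funM.
  - by move=> x; rewrite /= funenegE funeposE; exact: poweR_log_tangent.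
rewrite (@integral_series_posneg _ _ _ mu B f)//.
have U0 := integral_series_ge0 mu B (P0 a).
have G0 := integral_series_ge0 mu B (P0 g).
have N0 := integral_series_ge0 mu B fn0.
have Q0 := integral_series_ge0 mu B fp0.
move: main fn_oo aoo U0 G0 N0 Q0.
move: (isum f^\-) (isum f^\+) (isum (fun x => Z x `^ a)) (isum (fun x => Z x `^ g)).
move: b_ge0 (c_gt0 s); set b := (_ * _)%R; set c := (_ * _)%R => b_ge0 c_gt.
move=> N Q U G main Noo Uoo U0 G0 N0 Q0.
case: N main Noo N0 => [n||]// main _ _; case: U main Uoo U0 => [u||]// main _ _.
case: Q main Q0 => [q||]// main _; last first.
  by rewrite addye// gt0_muley ?lte_fin// addey// leey.
have -> : u%:E + c%:E * (q%:E - n%:E) = u%:E + c%:E * q%:E - c%:E * n%:E.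
  by rewrite muleBr// addeA.
by rewrite leeBrDr.
Qed.

End tangent_series.

(** * Measures given by a density *)

Section density_measure.
Context {d : measure_display} {T : measurableType d} {R : realType}.
Variables (mu : {measure set T -> \bar R}) (h : T -> \bar R).
Hypothesis h_ge0 : forall x, 0 <= h x.
Hypothesis mh : measurable_fun [set: T] h.

Definition density_measure (A : set T) : \bar R := \int[mu]_(x in A) h x.

Let density0 : density_measure set0 = 0.
Proof. exact: integral_set0. Qed.

Let density_ge0 A : 0 <= density_measure A.
Proof. exact: integral_ge0. Qed.

Let density_sigma_additive : semi_sigma_additive density_measure.
Proof.
move=> F mF tF mUF; rewrite /density_measure ge0_integral_bigcup//.
  by apply: is_cvg_nneseries => n _ _; exact: integral_ge0.
exact: measurable_funTS.
Qed.

#[local] HB.instance Definition _ := isMeasure.Build _ _ _ density_measure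
  density0 density_ge0 density_sigma_additive.

(** The measure structure is local to this section; this form hands it on, so that the results on
    [shift_outer] apply to the density $Z^a$. *)
Lemma density_measureP :
  exists nu : {measure set T -> \bar R}, nu = density_measure :> (set T -> \bar R).
Proof. by exists density_measure. Qed.

End density_measure.

(** * The Hellinger and Kullback functionals *)

Section two_sided_shift.
Context {d : measure_display} {X : measurableType d} {R : realType}.
Variable S : X -> X.
Hypothesis S_bij : bijective S.

Lemma iter_bij n : bijective (iter n S).
Proof. by elim: n => [|n IH]; [exists id|exact: bij_comp]. Qed.

Lemma zimageN n (A : set X) : zimage S (- n%:Z) A = iter n S @^-1` A.
Proof. by case: n => //=; rewrite image_id. Qed.

(** The preimage under [S] sends a generator $S^{-i}B$ of the past to the generator
    $S^{-(i+1)}B$. *)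
Lemma measurable_shift : measurable_fun [set: pastType S] (S : pastType S -> pastType S).
Proof.
apply: (@measurability _ _ (pastType S) (pastType S) _ _ (past_gen S)) => //.
move=> _ [_ [i _ [B mB <-]] <-]; rewrite setTI.
apply: sub_sigma_algebra; exists i.+1 => //; exists B => //.
by rewrite !zimageN -addn1 preimage_iterD.
Qed.

Lemma past_atE n (A : set X) : past_at S n A <-> past S (iter n S @^-1` A).
Proof.
have [g gS Sg] := iter_bij n.
split=> [[B pB <-]|pA].
  rewrite (_ : _ @^-1` _ = B)//; apply/seteqP; split => x /=.
    by move=> [y By /(can_inj gS) <-].
  by move=> Bx; exists x.
exists (iter n S @^-1` A) => //; apply/seteqP; split => x /=.
  by move=> [y Ay <-].
by move=> Ax; exists (g x); rewrite /= Sg.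
Qed.

Lemma coveringsE Q : coverings S Q = @shift_cover _ (pastType S) S Q.
Proof.
apply/seteqP; split => A [mA QA]; split => // n; first by have /past_atE := mA n.
by apply/past_atE; exact: mA.
Qed.

Lemma outerE (mu : set (pastType S) -> \bar R) Q :
  outer mu Q = @shift_outer _ (pastType S) R S mu Q.
Proof.
rewrite /outer /shift_outer coveringsE; congr ereal_inf.
apply: eq_imagel => A _; apply: eq_eseriesr => n _; by rewrite zimageN.
Qed.

End two_sided_shift.

Section log_bound.
Context {R : realType}.

(* Linear in D for each s; the choice s = max (th D / k, -1) is optimal. *)
Lemma min_expeR_le (k th eta : R) (D : \bar R) :
  (0 < k)%R -> (0 < th)%R -> (0 <= eta)%R ->
  (forall s : R, (-1 <= s)%R ->
    (expR (- s) * (1 + s) * k)%:E <= eta%:E + (expR (- s) * th)%:E * D) ->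
  k%:E * mine (expeR (- ((th / k)%:E * D))) (expR 1)%:E <= eta%:E.
Proof.
move=> k0 th0 eta0 H.
have thk : (0 < th / k)%R by rewrite divr_gt0.
case: D H => [r||] H.
- rewrite -EFinM -EFinN [expeR _]/= -EFin_min -EFinM lee_fin.
  have [sr|sr] := leP (-1)%R (th / k * r)%R.
    apply: (@le_trans _ _ (k * expR (- (th / k * r)))%R).
      by rewrite ler_wpM2l ?ge_min ?lexx// ltW.
    (* With [s = th / k * r] the terms with factor [s] cancel, leaving $k e^{-s}\le\eta$. *)
    have := H _ sr; rewrite -EFinM -EFinD lee_fin.
    set E := expR _; have -> : (E * th * r = E * (th / k * r) * k)%R.
      by field; rewrite gt_eqF.
    lra.
  apply: (@le_trans _ _ (k * expR 1)%R).
    by rewrite ler_wpM2l ?ge_min ?lexx ?orbT// ltW.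
  (* At [s = -1] the hypothesis reads $-e\,\theta r\le\eta$, and here $\theta r\le -k$. *)
  have := H _ (lexx (-1)%R); rewrite -EFinM -EFinD lee_fin subrr mulr0 mul0r opprK.
  have e0 := expR_gt0 (1 : R).
  have : (th * r <= - k)%R.
    have -> : (th * r = th / k * r * k)%R by field; rewrite gt_eqF.
    nra.
  nra.
- by rewrite gt0_muley ?lte_fin//= min_l ?mule0 ?lee_fin// expR_ge0.
(* The value [D = -oo] is impossible: [s = 0] would give [k <= -oo]. *)
- have /H : (-1 <= 0 :> R)%R by lra.
  by rewrite oppr0 expR0 !mul1r addr0 gt0_muleNy ?lte_fin.
Qed.

Lemma mine_leW (k eta : R) (x y : \bar R) : (0 < k)%R -> k%:E * mine x y <= eta%:E ->
  eta%:E < k%:E * y -> k%:E * x <= eta%:E.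
Proof.
by move=> k0; have [//|xy] := leP x y; move=> h1 /(le_lt_trans h1); rewrite ltxx.
Qed.

(** Young's inequality at [t = 0], whose coefficients [p] and [1 - p] are at most 1. It is the
    source of the finiteness of the Hellinger quantities. *)
Lemma poweR_le_add (a0 a : R) (z : \bar R) : (0 <= a0)%R -> (a0 <= a)%R -> (a <= 1)%R ->
  0 <= z -> z `^ a <= z `^ a0 + z.
Proof.
move=> a00 a0a; rewrite le_eqVlt => /predU1P[->|a1] z0.
  by rewrite poweRe1// leeDr// poweR_ge0.
have d0 : (0 < 1 - a0)%R by lra.
have pE : ((1 - a) / (1 - a0) * (1 - a0) = 1 - a)%R by rewrite divfK// gt_eqF.
apply: le_trans (poweR_young 0 a00 a0a a1 pE z0) _.
rewrite !mulr0 oppr0 expR0 !mulr1; set p := ((1 - a) / _)%R.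
have p0 : (0 <= p)%R by rewrite divr_ge0//; lra.
have p1 : (p <= 1)%R by rewrite ler_pdivrMr//; lra.
by apply: leeD; apply: gee_pMl; rewrite ?poweR_ge0// lee_fin; lra.
Qed.

End log_bound.

(** * Hoelder and tangent bounds for the Hellinger functionals *)

Section hellinger_theory.
Context {R : realType} {d : measure_display} {X : measurableType d}.
Variable S : X -> X.
Hypothesis S_bij : bijective S.
Variables (phi0 Lambda : {finite_measure set (pastType S) -> \bar R}).
Hypothesis Lambda_inv : forall B : set X, past S B -> Lambda (S @^-1` B) = Lambda B.
Variable Z : pastType S -> \bar R.
Hypothesis Z_density : is_density Lambda phi0 Z.

Let Z_ge0 : forall x, 0 <= Z x. Proof. by case: Z_density. Qed.
Let mZ : measurable_fun [set: pastType S] Z. Proof. by case: Z_density. Qed.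

Local Notation Zp a := (fun x => Z x `^ a).
Local Notation H := (hellinger phi0 Z).

Let mZp a : measurable_fun [set: pastType S] (Zp a).
Proof. exact: measurable_poweR_comp. Qed.

Let Zp_ge0 a x : 0 <= Z x `^ a. Proof. exact: poweR_ge0. Qed.

Lemma cover_sumE f (A : nat -> set X) : cover_sum phi0 f A =
  \sum_(n <oo) \int[phi0]_(x in (iter n S @^-1` A n : set (pastType S))) f x.
Proof. by apply: eq_eseriesr => n _; rewrite zimageN. Qed.

Lemma measurable_covering Q A : coverings S Q A ->
  forall n, measurable (iter n S @^-1` A n : set (pastType S)).
Proof. by rewrite coveringsE// => -[]. Qed.

Lemma cover_sum_density Q A : coverings S Q A ->
  cover_sum phi0 Z A = \sum_(n <oo) Lambda (iter n S @^-1` A n).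
Proof.
move=> QA; rewrite cover_sumE; apply: eq_eseriesr => n _.
by case: Z_density => _ _ ->//; exact: measurable_covering QA n.
Qed.

Lemma cover_sum1 A : cover_sum phi0 (Zp 1) A = cover_sum phi0 Z A.
Proof.
by rewrite !cover_sumE; apply: eq_eseriesr => n _; apply: eq_integral => x _; rewrite poweRe1.
Qed.

Lemma outer_le_cover_sum Q A : coverings S Q A ->
  outer Lambda Q <= cover_sum phi0 Z A.
Proof.
move=> QA; rewrite (cover_sum_density QA) outerE//.
by apply: shift_outer_le; rewrite -coveringsE.
Qed.

Lemma hellinger0 Q : H 0 Q = outer phi0 Q.
Proof.
rewrite /hellinger /outer; congr ereal_inf; apply: eq_imagel => A QA.
rewrite cover_sumE; apply: eq_eseriesr => n _; rewrite zimageN.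
under eq_integral do rewrite poweRe0.
by rewrite integral_cst ?mul1e//; exact: measurable_covering QA n.
Qed.

Lemma hellinger_shift_outer a Q :
  H a Q = @shift_outer _ (pastType S) R S (density_measure phi0 (Zp a)) Q.
Proof. by rewrite -outerE. Qed.

Lemma density_measure_fin a : (0 <= a)%R -> (a <= 1)%R ->
  density_measure phi0 (Zp a) setT < +oo.
Proof.
move=> a0 a1; have ZT : \int[phi0]_x Z x < +oo.
  case: Z_density => _ _ <-//; rewrite -ge0_fin_numE//; exact: fin_num_measure.
apply: (@le_lt_trans _ _ (\int[phi0]_x (1 + Z x))).
  apply: ge0_le_integral => //; first exact: emeasurable_funD.
  by move=> x _; have := poweR_le_add (lexx 0%R) a0 a1 (Z_ge0 x); rewrite poweRe0.
rewrite ge0_integralD// lte_add_pinfty// integral_cst// mul1e -ge0_fin_numE//.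
exact: fin_num_measure.
Qed.

Lemma hellinger_ge0 a Q : 0 <= H a Q.
Proof.
rewrite hellinger_shift_outer.
have [nu nuE] := density_measureP phi0 (Zp_ge0 a) (mZp a).
rewrite -nuE; exact: shift_outer_ge0.
Qed.

Lemma hellinger_fin_num a Q : (0 <= a)%R -> (a <= 1)%R -> H a Q \is a fin_num.
Proof.
move=> a0 a1; rewrite hellinger_shift_outer.
have [nu nuE] := density_measureP phi0 (Zp_ge0 a) (mZp a).
rewrite -nuE; apply: shift_outer_fin_num; rewrite nuE; exact: density_measure_fin.
Qed.

Lemma LambdaT : Lambda setT < +oo.
Proof. by rewrite -ge0_fin_numE//; exact: fin_num_measure. Qed.

Lemma outer_Lambda_fin_num Q : outer Lambda Q \is a fin_num.
Proof. by rewrite outerE//; apply: shift_outer_fin_num; exact: LambdaT. Qed.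

Lemma common_covering a Q (e : R) : (0 <= a)%R -> (a <= 1)%R -> (0 < e)%R ->
  exists A, [/\ coverings S Q A, cover_sum phi0 (Zp a) A <= H a Q + e%:E &
    cover_sum phi0 Z A <= outer Lambda Q + e%:E].
Proof.
move=> a0 a1 e0.
have [nu nuE] := density_measureP phi0 (Zp_ge0 a) (mZp a).
have nuT : nu setT < +oo by rewrite nuE; exact: density_measure_fin.
have [A [QA HA LA]] := common_shift_cover (@measurable_shift _ _ S) nuT LambdaT
  Lambda_inv (measure_addE nu Lambda) S_bij Q e0.
rewrite -coveringsE// in QA.
exists A; split => //; first by rewrite cover_sumE hellinger_shift_outer -nuE; move: HA; rewrite nuE.
by rewrite (cover_sum_density QA) outerE.
Qed.

(** Hoelder's inequality in threshold form, obtained by integrating Young's inequality with the same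
    [t] along a common nearly optimal covering. *)
Lemma hellinger_lt (a0 a p t : R) Q : (0 <= a0)%R -> (a0 <= a)%R -> (a < 1)%R ->
  (p * (1 - a0) = 1 - a)%R ->
  H a0 Q < outer Lambda Q * (expR (- t))%:E ->
  H a Q < outer Lambda Q * (expR (- (p * t)))%:E.
Proof.
move=> a00 a0a a1 pE.
have a0_le1 : (a0 <= 1)%R by lra.
have a_ge0 : (0 <= a)%R by lra.
have p0 : (0 < p)%R by nra.
have p1 : (p <= 1)%R by nra.
pose c1 := (p * expR ((1 - p) * t))%R.
pose c2 := ((1 - p) * expR (- (p * t)))%R.
have c1_gt0 : (0 < c1)%R by rewrite mulr_gt0 ?expR_gt0.
have c2_ge0 : (0 <= c2)%R by rewrite mulr_ge0 ?expR_ge0//; lra.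
have key e : (0 < e)%R ->
    H a Q <= c1%:E * (H a0 Q + e%:E) + c2%:E * (outer Lambda Q + e%:E).
  move=> e0; have [A [QA Ha0 HL]] := common_covering Q a00 a0_le1 e0.
  have mA := measurable_covering QA.
  apply: (@le_trans _ _ (cover_sum phi0 (Zp a) A)).
    by apply: ereal_inf_lbound; exists A.
  apply: (@le_trans _ _ (c1%:E * cover_sum phi0 (Zp a0) A + c2%:E * cover_sum phi0 Z A)).
    rewrite !cover_sumE -(integral_seriesZl phi0 mA (ltW c1_gt0))//
      -(integral_seriesZl phi0 mA c2_ge0)//.
    rewrite -(integral_seriesD phi0 mA)//;
      try exact: emeasurable_funM;
      try by move=> x; apply: mule_ge0; rewrite ?lee_fin// ltW.
    apply: (le_integral_series phi0 mA) => //.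
      by apply: emeasurable_funD; exact: emeasurable_funM.
    by move=> x; exact: poweR_young.
  by apply: leeD; apply: lee_wpmul2l; rewrite ?lee_fin// ltW.
move: key.
rewrite -(fineK (hellinger_fin_num Q a_ge0 (ltW a1))).
rewrite -(fineK (hellinger_fin_num Q a00 a0_le1)) -(fineK (outer_Lambda_fin_num Q)).
set h := fine _; set h0 := fine _; set l := fine _ => key.
rewrite -!EFinM !lte_fin => h0l.
have h_le : (h <= c1 * h0 + c2 * l)%R.
  apply/ler_addgt0Pr => e e0.
  have c12 : (0 < c1 + c2)%R by lra.
  have := key _ (divr_gt0 e0 c12).
  rewrite -!EFinD lee_fin => /le_trans; apply.
  rewrite le_eqVlt; apply/orP; left; apply/eqP; field; exact: lt0r_neq0.
apply: le_lt_trans h_le _.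
(* At [h0 = l * expR (- t)] Young's bound is exactly the target; strictness carries over because
   [c1 > 0]. *)
have -> : (l * expR (- (p * t)) = c1 * (l * expR (- t)) + c2 * l)%R.
  rewrite /c1 /c2 (_ : (1 - p) * t = - (p * t) + t)%R; last by ring.
  rewrite expRD expRN [expR (- t)]expRN; field.
  by rewrite !gt_eqF ?expR_gt0.
by rewrite ltrD2r ltr_pM2l.
Qed.

(** Along an admissible covering the $Z^a$ sum is below [H a Q + eps] and the $Z^g$ sum is at least
    [k], so [tangent_series] bounds the logarithmic sum from below. *)
Lemma tangent_eps (a g eps s k : R) Q :
  (0 <= a)%R -> (a < g)%R -> (g <= 1)%R -> (-1 <= s)%R -> (0 <= k)%R ->
  k%:E <= hellinger_eps phi0 Z g a eps Q ->
  (expR (- s) * (1 + s) * k)%:E <= H a Q + eps%:E +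
    (expR (- s) * (g - a))%:E * hellinger_log_eps phi0 Z g a eps Q.
Proof.
move=> a0 ag g1 s1 k0 kH.
have c0 : (0 < expR (- s) * (g - a))%R by rewrite mulr_gt0 ?expR_gt0//; lra.
have b0 : (0 <= expR (- s) * (1 + s))%R by rewrite mulr_ge0 ?expR_ge0//; lra.
set b := (expR (- s) * (1 + s))%R in b0 *.
set c := (expR (- s) * (g - a))%R in c0 *.
have a1 : (a <= 1)%R by lra.
have Hfin := hellinger_fin_num Q a0 a1.
(* Solved for the logarithmic sum, the bound is a real constant, which passes to the infimum over
   coverings. *)
suff : ((b * k - fine (H a Q) - eps) / c)%:E <= hellinger_log_eps phi0 Z g a eps Q.
  rewrite -(@lee_pmul2l _ c%:E) ?lte_fin// => /(leeD (lexx (H a Q + eps%:E))).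
  apply: le_trans; rewrite -{1}(fineK Hfin) -!EFinM -!EFinD lee_fin.
  by rewrite [(c * _)%R]mulrC divfK ?gt_eqF//; lra.
apply: le_ereal_inf_tmp => _ [A [QA Aeps] <-].
have kA : k%:E <= cover_sum phi0 (Zp g) A.
  by apply: le_trans kH _; apply: ereal_inf_lbound; exists A.
have mA := measurable_covering QA.
have Aoo : cover_sum phi0 (Zp a) A < +oo.
  by apply: lt_le_trans Aeps _; rewrite leey.
rewrite cover_sumE in Aoo; have := tangent_series mA Z_ge0 mZ a0 ag s1 Aoo.
rewrite -!cover_sumE -/b -/c => main.
have {main}: (b * k)%:E <= (fine (H a Q) + eps)%:E +
    c%:E * cover_sum phi0 (fun x => Z x `^ g * lne (Z x)) A.
  rewrite EFinD fineK// EFinM.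
  apply: le_trans (le_trans main _); first by apply: lee_wpmul2l; rewrite ?lee_fin.
  by rewrite leeD2r// ltW.
case: (cover_sum _ _ _) => [D||]; last 2 first.
- by rewrite leey.
- by rewrite gt0_muleNy ?lte_fin.
by rewrite -EFinM -EFinD !lee_fin => main; rewrite ler_pdivrMr//; lra.
Qed.

Lemma hellinger_eps_ge (a eps : R) Q :
  outer Lambda Q <= hellinger_eps phi0 Z 1 a eps Q.
Proof.
apply: le_ereal_inf_tmp => _ [A [QA _] <-].
by rewrite cover_sum1; exact: outer_le_cover_sum.
Qed.

(** A common covering with error [eps / 2] meets the strict admissibility condition, and its $Z^g$
    sum is finite because $Z^g\le Z^a+Z$. *)
Lemma hellinger_eps_fin_num (a g eps : R) Q :
  (0 <= a)%R -> (a < g)%R -> (g <= 1)%R -> (0 < eps)%R ->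
  hellinger_eps phi0 Z g a eps Q \is a fin_num.
Proof.
move=> a0 ag g1 eps0.
have a1 : (a <= 1)%R by lra.
have e20 : (0 < eps / 2)%R by rewrite divr_gt0.
have [A [QA HA LA]] := common_covering Q a0 a1 e20.
have mA := measurable_covering QA.
rewrite ge0_fin_numE; last first.
  by apply: le_ereal_inf_tmp => _ [B _ <-]; rewrite cover_sumE; exact: integral_series_ge0.
apply: (@le_lt_trans _ _ (cover_sum phi0 (Zp g) A)).
  apply: ereal_inf_lbound; exists A => //; split => //.
  apply: le_lt_trans HA _; rewrite lteD2lE ?hellinger_fin_num// lte_fin; lra.
apply: (@le_lt_trans _ _ (cover_sum phi0 (Zp a) A + cover_sum phi0 Z A)).
  rewrite !cover_sumE -(integral_seriesD phi0 mA)//; apply: (le_integral_series phi0 mA) => //.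
    exact: emeasurable_funD.
  by move=> x; apply: poweR_le_add => //; exact: ltW.
apply: le_lt_trans (leeD HA LA) _.
by rewrite ltey_eq !fin_numD hellinger_fin_num// outer_Lambda_fin_num.
Qed.

(** Shrinking [eps] leaves fewer admissible coverings, so the infimum grows and the limit at 0 from
    the right is a supremum. *)
Lemma kullback_eps_le (a eps : R) Q : (0 < eps)%R ->
  kullback_eps phi0 Z a eps Q <= kullback phi0 Z a Q.
Proof.
move=> eps0; rewrite /kullback.
rewrite (cvg_lim _ (@nonincreasing_at_right_cvge _ (fun e => kullback_eps phi0 Z a e Q)
  0%R (BInfty R false) _ _))//.
- apply: ereal_sup_ubound; exists eps => //=.
  by rewrite in_itv/= eps0.
- move=> x y _ _ xy; apply: le_ereal_inf => _ [A [QA Ax] <-]; exists A => //.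
  by split => //; apply: lt_le_trans Ax _; rewrite leeD2l// lee_fin.
Qed.

(** Once every [kullback_eps] is replaced by the larger [kullback], the error [e] enters only
    additively and can tend to 0. *)
Lemma tangent_kullback (a s l : R) Q :
  (0 <= a)%R -> (a < 1)%R -> (-1 <= s)%R -> (0 <= l)%R -> l%:E <= outer Lambda Q ->
  (expR (- s) * (1 + s) * l)%:E <=
    H a Q + (expR (- s) * (1 - a))%:E * kullback phi0 Z a Q.
Proof.
move=> a0 a1 s1 l0 lL; apply/lee_addgt0Pr => e e0; rewrite addeAC.
apply: le_trans (tangent_eps a0 a1 (lexx 1%R) s1 l0
  (le_trans lL (hellinger_eps_ge a e Q))) _.
rewrite leeD2l// lee_wpmul2l ?lee_fin ?mulr_ge0 ?expR_ge0//; first lra.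
exact: kullback_eps_le.
Qed.

End hellinger_theory.

(** * Lower bounds for the Hellinger functional and for Phi *)

Theorem theorem1 (R : realType) (d : measure_display) (X : measurableType d)
    (S : X -> X) (S_bij : bijective S)
    (phi0 Lambda : {finite_measure set (pastType S) -> \bar R})
    (Lambda_inv : forall B : set X, past S B -> Lambda (S @^-1` B) = Lambda B)
    (Lambda_phi0 : Lambda `<< phi0)
    (Z : pastType S -> \bar R) (Z_density : is_density Lambda phi0 Z)
    (Q : set X) (Q_full : full S Q)
    (alpha gamma : R) (alpha_ge0 : (0 <= alpha)%R)
    (alpha_gamma : (alpha < gamma)%R) (gamma_le1 : (gamma <= 1)%R) :
  let Phi := outer phi0 in
  let LambdaX := outer Lambda in
  let H := hellinger phi0 Z in
  let Heps := hellinger_eps phi0 Z in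
  let Deps := hellinger_log_eps phi0 Z in
  let Keps := kullback_eps phi0 Z in
  let K := kullback phi0 Z in
  (* (i) *)
  ((forall eps : R, (0 < eps)%R -> 0 < Heps gamma alpha eps Q ->
      H alpha Q >=
        Heps gamma alpha eps Q *
        mine (expeR (- ((gamma - alpha)%:E / Heps gamma alpha eps Q
                        * Deps gamma alpha eps Q)))
             (expR 1)%:E
        - eps%:E)
   /\
   (0 < LambdaX Q ->
      Phi Q >=
        LambdaX Q *
        mine (expeR (- ((LambdaX Q)^-1 * K alpha Q)))
             (expR (1 - alpha)^-1)%:E))
  /\
  (* (ii) *)
  (0 < LambdaX Q ->
    (forall alpha0 eps : R, (0 <= alpha0)%R -> (alpha0 <= alpha)%R ->
       (0 < eps)%R ->
       eps%:E < LambdaX Q *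
         ((expR 1)%:E
          - (H alpha0 Q / LambdaX Q) `^ ((1 - alpha) / (1 - alpha0))) ->
       H alpha Q >=
         LambdaX Q *
         expeR (- ((1 - alpha)%:E / LambdaX Q * Keps alpha eps Q))
         - eps%:E)
    /\
    ((exists alpha0 : R, [/\ (0 <= alpha0)%R, (alpha0 <= alpha)%R &
        H alpha0 Q <
          LambdaX Q * (expR ((1 - alpha0) / (1 - alpha)))%:E]) ->
       H alpha Q >=
         LambdaX Q *
         expeR (- ((1 - alpha)%:E / LambdaX Q * K alpha Q)))).
Proof.
have alpha_lt1 : (alpha < 1)%R by exact: lt_le_trans alpha_gamma gamma_le1.
have alpha_le1 := ltW alpha_lt1.
move=> Phi LambdaX H Heps Deps Keps K.
have Hfin : H alpha Q \is a fin_num by exact: (hellinger_fin_num S_bij Z_density).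
have H_ge0 a : 0 <= H a Q by exact: (hellinger_ge0 S_bij Z_density).
have L_fin : LambdaX Q \is a fin_num by exact: outer_Lambda_fin_num.
(* [k] stays free: part (i) uses the value of [Heps], part (ii) uses [g = 1] and [k = LambdaX Q]. *)
have Heps_bound (g eps k : R) : (alpha < g)%R -> (g <= 1)%R -> (0 < eps)%R ->
    (0 < k)%R -> k%:E <= Heps g alpha eps Q ->
    k%:E * mine (expeR (- (((g - alpha) / k)%:E * Deps g alpha eps Q))) (expR 1)%:E
    <= H alpha Q + eps%:E.
  move=> ag g1 eps0 k0 kH; rewrite -(fineK Hfin) -EFinD.
  apply: min_expeR_le => //; first by rewrite subr_gt0.
    by rewrite addr_ge0 ?fine_ge0// ltW.
  move=> s s1; rewrite EFinD fineK//.
  by apply: (tangent_eps S_bij Z_density) => //; exact: ltW.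
have K_bound (k : R) : (0 < k)%R -> k%:E = LambdaX Q ->
    k%:E * mine (expeR (- (((1 - alpha) / k)%:E * K alpha Q))) (expR 1)%:E
    <= H alpha Q.
  move=> k0 kL; rewrite -(fineK Hfin).
  apply: min_expeR_le => //; [by rewrite subr_gt0|by rewrite fine_ge0|].
  move=> s s1; rewrite fineK//.
  by apply: (tangent_kullback S_bij Z_density) => //; [exact: ltW|rewrite kL].
split; [split|].
- move=> eps eps0 Heps0.
  have kfin : Heps gamma alpha eps Q \is a fin_num.
    exact: (hellinger_eps_fin_num S_bij Lambda_inv Z_density).
  move: (Heps_bound gamma eps) kfin Heps0.
  case: (Heps gamma alpha eps Q) => [k||]// Hb _; rewrite lte_fin => k0.
  by rewrite inver gt_eqF// leeBlDr// -EFinM; exact: Hb.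
- move=> L0; have lE := fineK L_fin; move: L0.
  rewrite -lE lte_fin inver; set l := fine _ => l0; rewrite gt_eqF//.
  have HK := K_bound l l0 lE.
  have s0 : (-1 <= 0 :> R)%R by rewrite oppr_le0.
  have lL : l%:E <= LambdaX Q by rewrite lE.
  (* The instance [s = 0] excludes [K alpha Q = -oo]. *)
  have := tangent_kullback S_bij Z_density alpha_ge0 alpha_lt1 s0 (ltW l0) lL.
  rewrite -/(K alpha Q) oppr0 expR0 addr0 !mul1r.
  (* Hoelder's inequality from exponent 0, where [p = 1 - alpha]. *)
  have HK_lt t : Phi Q < l%:E * (expR (- t))%:E ->
      H alpha Q < l%:E * (expR (- ((1 - alpha) * t)))%:E.
    rewrite /Phi lE -(hellinger0 S_bij phi0 Z).
    apply: (hellinger_lt S_bij Lambda_inv Z_density) => //.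
    by rewrite subr0 mulr1.
  move: HK; case: (K alpha Q) => [k||] HK T0; rewrite leNgt; apply/negP; last 2 first.
  + rewrite gt0_muley ?lte_fin ?invr_gt0//= min_l ?lee_fin ?expR_ge0// mule0.
    by rewrite ltNge /Phi -(hellinger0 S_bij phi0 Z) H_ge0.
  + move: T0; rewrite gt0_muleNy ?lte_fin ?subr_gt0// addeNy.
    by [].
  rewrite -EFinM -EFinN [expeR _]/= -EFin_min.
  move: HK; rewrite -!EFinM -EFinN [expeR _]/= -EFin_min.
  have d0 : (0 < 1 - alpha)%R by rewrite subr_gt0.
  (* The minima in [HK] and in the claim switch at the same value of [k / l]. If the claim failed,
     [HK_lt] with [t] equal to [k / l] on one side and to $-1/(1-\alpha)$ on the other would
     contradict [HK]. *)
  have [ml|lm] := leP (- (1 - alpha)^-1)%R (l^-1 * k)%R.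
  + move=> HK PhiL.
    have /HK_lt : Phi Q < l%:E * (expR (- (l^-1 * k)))%:E.
      apply: lt_le_trans PhiL _.
      by rewrite -?EFinM lee_fin ler_pM2l// ge_min lexx.
    rewrite ltNge; apply/negP; rewrite negbK; apply: le_trans HK.
    rewrite min_l ?lee_fin ?mulrA// ler_expR.
    have := ler_wpM2l (ltW d0) ml.
    by rewrite mulrN divff ?gt_eqF// mulrA lerNl.
  + move=> HK PhiL.
    have /HK_lt : Phi Q < l%:E * (expR (- (- (1 - alpha)^-1)))%:E.
      apply: lt_le_trans PhiL _.
      by rewrite opprK -?EFinM lee_fin ler_pM2l// ge_min lexx orbT.
    rewrite mulrN divff ?gt_eqF// opprK.
    rewrite ltNge; apply/negP; rewrite negbK; apply: le_trans HK.
    rewrite min_r// ler_expR.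
    have := ltW lm; rewrite -(ler_pM2l d0).
    by rewrite mulrN divff ?gt_eqF// mulrA lerNr.
move=> L0; have lE := fineK L_fin; move: L0.
rewrite -lE lte_fin inver; set l := fine _ => l0; rewrite gt_eqF//.
split.
- move=> alpha0 eps alpha00 alpha0a eps0.
  have H0fin : H alpha0 Q \is a fin_num.
    apply: (hellinger_fin_num S_bij Z_density) => //; exact: le_trans alpha0a alpha_le1.
  have H00 := H_ge0 alpha0.
  rewrite -(fineK H0fin); set h0 := fine _.
  rewrite -[h0%:E * _]EFinM poweR_EFin -EFinB -[l%:E * (_ - _)%:E]EFinM lte_fin => epsL.
  rewrite leeBlDr// -[(1 - alpha)%:E * _]EFinM.
  have := Heps_bound 1%R eps l alpha_lt1 (lexx _) eps0 l0.
  rewrite {1}lE => /(_ (hellinger_eps_ge S_bij Z_density _ _ _)).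
  (* The cap [e] may be dropped once [H alpha Q + eps] is shown to lie below [l * expR 1]. *)
  rewrite -(fineK Hfin) -EFinD => /(mine_leW l0); apply.
  have d0 : (0 < 1 - alpha)%R by rewrite subr_gt0.
  have d1 : (0 < 1 - alpha0)%R by rewrite subr_gt0 (le_lt_trans alpha0a).
  pose p := ((1 - alpha) / (1 - alpha0))%R.
  have p0 : (0 < p)%R by rewrite divr_gt0.
  have pE : (p * (1 - alpha0) = 1 - alpha)%R by rewrite divfK// gt_eqF.
  (* The condition on [eps] says that $(h_0/l)^p<y$; [t] is then chosen with $e^{-pt}=y$, so
     Hoelder's inequality gives $H_\alpha<l\,y=l\,e-\epsilon$. *)
  pose y := (expR 1 - eps / l)%R.
  have hy : ((h0 / l) `^ p < y)%R.
    move: epsL; rewrite -/p mulrC -ltr_pdivrMr//.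
    by rewrite /y; lra.
  have y0 : (0 < y)%R by exact: le_lt_trans (powR_ge0 _ _) hy.
  pose t := (- (ln y / p))%R.
  have ptE : (- (p * t) = ln y)%R by rewrite /t; field; rewrite gt_eqF.
  have h0l : H alpha0 Q < LambdaX Q * (expR (- t))%:E.
    rewrite -lE -(fineK H0fin) -EFinM lte_fin mulrC -ltr_pdivrMr// ltNge.
    apply/negP => th; move: hy; rewrite ltNge => /negP; apply.
    rewrite -(lnK y0) -ptE -mulrN mulrC expRM.
    apply: ge0_ler_powR => //; rewrite ?nnegrE ?expR_ge0 ?(ltW p0)//.
    by apply: divr_ge0; [exact: fine_ge0|exact: ltW].
  have := hellinger_lt S_bij Lambda_inv Z_density alpha00 alpha0a alpha_lt1 pE h0l.
  rewrite ptE lnK ?posrE// -/(H alpha Q) -/(LambdaX Q) -lE -(fineK Hfin) -!EFinM !lte_fin /y.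
  rewrite (_ : l * (expR 1 - eps / l) = l * expR 1 - eps)%R; last first.
    by field; rewrite gt_eqF.
  by rewrite -ltrBrDr.
move=> [alpha0 [alpha00 alpha0a H0L]].
have d0 : (0 < 1 - alpha)%R by rewrite subr_gt0.
have d1 : (0 < 1 - alpha0)%R by rewrite subr_gt0 (le_lt_trans alpha0a).
have pE : ((1 - alpha) / (1 - alpha0) * (1 - alpha0) = 1 - alpha)%R.
  by rewrite divfK// gt_eqF.
(* This choice makes $-pt=1$, so Hoelder's inequality gives $H_\alpha<l\,e$ and the cap is again
   inactive. *)
pose t := (- ((1 - alpha0) / (1 - alpha)))%R.
have h0l : H alpha0 Q < LambdaX Q * (expR (- t))%:E by rewrite -lE opprK.
have := hellinger_lt S_bij Lambda_inv Z_density alpha00 alpha0a alpha_lt1 pE h0l.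
rewrite (_ : - _ = 1)%R; last by rewrite /t; field; rewrite !gt_eqF.
rewrite -/(H alpha Q) -/(LambdaX Q) -lE => HL.
have := K_bound l l0 lE; rewrite -[(1 - alpha)%:E * _]EFinM.
by move: HL; rewrite -(fineK Hfin) => HL /(mine_leW l0); exact.
Qed.
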